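(* Let $F(x,y)=(x-P(x,y)+X(x,y),\; y+Q(x,y)+Y(x,y))$ be a map of the plane of the form described in the context. Suppose that the symmetric coefficient tensors $\mathscr A,\mathscr B,\mathscr C,\mathscr D,\mathscr E,\mathscr H$ of $$\frac{\partial P}{\partial x},\quad \frac{\partial Q}{\partial y},\quad \frac{\partial P}{\partial x}+\frac{\partial P}{\partial y},\quad \frac{\partial P}{\partial x}-\frac{\partial P}{\partial y},\quad \frac{\partial Q}{\partial y}+\frac{\partial Q}{\partial x},\quad \frac{\partial Q}{\partial y}-\frac{\partial Q}{\partial x},$$ respectively, are all positive definite. Then there is a neighborhood $K$ of $(0,0)$ such that $F$ has the finite shadowing property in the set $K$.
   Context: Setting: $F=(f,g):\mathbb R^2\to\mathbb R^2$, $F(x,y)=(x-P(x,y)+X(x,y),\,y+Q(x,y)+Y(x,y))$, where $P$ and $Q$ are real homogeneous polynomials in two variables of degrees $2k+1$ and $2k'+1$ respectively, with $k,k'\ge 1$ integers, and $X,Y$ are higher-order terms than $P,Q$ respectively: $X,Y$ are $C^1$ functions with $X(0,0)=Y(0,0)=0$ and, as $(x,y)\to(0,0)$, the first partial derivatives of $X$ are $o(\|(x,y)\|^{2k})$ and those of $Y$ are $o(\|(x,y)\|^{2k'})$ (hence $X=o(\|(x,y)\|^{2k+1})$, $Y=o(\|(x,y)\|^{2k'+1})$). Thus $\mathbf 0=(0,0)$ is a fixed point of $F$. Tensors: for a real homogeneous polynomial $R$ of degree $m$ in $\mathbf x=(x_1,\dots,x_n)$, its symmetric coefficient tensor is the unique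 symmetric array $\mathscr B=(b_{i_1\cdots i_m})$ with $R(\mathbf x)=\mathscr B\mathbf x^m:=\sum_{i_1,\dots,i_m=1}^n b_{i_1\cdots i_m}x_{i_1}\cdots x_{i_m}$. A tensor $\mathscr B$ is positive definite if $\mathscr B\mathbf x^m>0$ for all $\mathbf x\in\mathbb R^n\setminus\{0\}$. Finite shadowing: let $(M,d)$ be a metric space (here $M=\mathbb R^2$ with the Euclidean metric) and $h:M\to M$ a map. For $\delta>0$ and $m\in\mathbb N$, a finite sequence $\{p_j\in M: 0\le j\le m\}$ is a $\delta$-pseudoorbit of $h$ if $d(p_{j+1},h(p_j))<\delta$ for $0\le j\le m-1$. It is $\epsilon$-shadowed by a point $q\in M$ if $d(h^j(q),p_j)<\epsilon$ for $0\le j\le m$. The map $h$ has the finite shadowing property in a set $K\subset M$ if for every $\epsilon>0$ there is $\delta>0$ such that every finite $\delta$-pseudoorbit $\{p_j\in K:0\le j\le m\}$ of $h$ (for any $m$) is $\epsilon$-shadowed by some point of $M$. *)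

(* Defs.v *)
From mathcomp Require Import all_boot all_order all_algebra.
From mathcomp Require Import all_classical all_reals all_analysis.
(* The notations of mpoly clash with those of mathcomp-analysis. *)
From mathcomp.multinomials Require Import -(notations) mpoly.

Set Implicit Arguments.
Unset Strict Implicit.
Unset Printing Implicit Defensive.

Import Order.TTheory GRing.Theory Num.Theory.
Import numFieldNormedType.Exports.

Local Open Scope classical_set_scope.
Local Open Scope ring_scope.

Definition homogeneous (R : realType) (d : nat) (p : mpoly 2 R) : Prop :=
  p \is ishomog1 d mdeg.

Definition dx (R : realType) (p : mpoly 2 R) : mpoly 2 R := mderiv ord0 p.
Definition dy (R : realType) (p : mpoly 2 R) : mpoly 2 R :=
  mderiv ord_max p.

Definition eval2 (R : realType) (p : mpoly 2 R) (z : R * R) : R :=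
  meval (fun i : 'I_2 => if i == ord0 then z.1 else z.2) p.

Definition tensor (R : realType) (n m : nat) := m.-tuple 'I_n -> R.

Definition tensor_form (R : realType) (n m : nat) (B : tensor R n m)
    (x : 'rV[R]_n) : R :=
  \sum_(t : m.-tuple 'I_n) B t * \prod_(i <- t) x 0 i.

Definition symmetric_tensor (R : realType) (n m : nat) (B : tensor R n m) :=
  forall s t : m.-tuple 'I_n, perm_eq s t -> B s = B t.

Definition coefficient_tensor (R : realType) (n m : nat) (B : tensor R n m)
    (p : mpoly n R) : Prop :=
  symmetric_tensor B /\
  forall x : 'rV[R]_n, meval (x 0) p = tensor_form B x.

Definition positive_definite (R : realType) (n m : nat) (B : tensor R n m) :=
  forall x : 'rV[R]_n, x != 0 -> 0 < tensor_form B x.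

(* The library norm on R * R is the sup norm, hence an explicit Euclidean one.
   Both induce the same topology. *)
Definition eunorm (R : realType) (z : R * R) : R :=
  Num.sqrt (z.1 ^+ 2 + z.2 ^+ 2).

Definition eudist (R : realType) (z w : R * R) : R := eunorm (z - w).

Definition C1 (R : realType) (f : R * R -> R) : Prop :=
  [/\ forall z, differentiable f z,
      continuous (fun z => 'D_(1, 0) f z) &
      continuous (fun z => 'D_(0, 1) f z)].

Definition higher_order_term (R : realType) (d : nat) (f : R * R -> R) : Prop :=
  [/\ C1 f, f 0 = 0,
      (fun z => 'D_(1, 0) f z) =o_ (0 : R * R) (fun z => eunorm z ^+ d) &
      (fun z => 'D_(0, 1) f z) =o_ (0 : R * R) (fun z => eunorm z ^+ d)].

Definition planar_map (R : realType) (P Q : mpoly 2 R) (X Y : R * R -> R)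
    (z : R * R) : R * R :=
  (z.1 - eval2 P z + X z, z.2 + eval2 Q z + Y z).

Section Shadowing.
Variables (R : realType) (M : Type) (dist : M -> M -> R) (h : M -> M).

(* A finite sequence p_0, ..., p_m is encoded by p : nat -> M, of which only
   the values at indices j <= m are used. *)
Definition pseudoorbit (delta : R) (m : nat) (p : nat -> M) : Prop :=
  forall j, (j < m)%N -> dist (p j.+1) (h (p j)) < delta.

Definition shadowed (eps : R) (m : nat) (p : nat -> M) (q : M) : Prop :=
  forall j, (j <= m)%N -> dist (iter j h q) (p j) < eps.

Definition finite_shadowing (K : set M) : Prop :=
  forall eps : R, 0 < eps -> exists2 delta : R, 0 < delta &
    forall (m : nat) (p : nat -> M),
      (forall j, (j <= m)%N -> K (p j)) -> pseudoorbit delta m p ->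
      exists q : M, shadowed eps m p q.

End Shadowing.

(* Main.v *)
Require Import Defs.
From mathcomp Require Import all_boot all_order all_algebra.
From mathcomp Require Import all_classical all_reals all_analysis.
From mathcomp.multinomials Require Import -(notations) mpoly.
From mathcomp Require Import ring lra.
Import Order.TTheory GRing.Theory Num.Theory.
Import numFieldNormedType.Exports.
Local Open Scope classical_set_scope.
Local Open Scope ring_scope.

(* Put the square of half-side e (for the sup norm) around each point of the
   pseudoorbit. The positivity of dP/dx +- dP/dy and dQ/dy +- dQ/dx says that,
   for the sup norm, the first component of F contracts and the second one
   expands vertical cones, by a factor 1 -+ c |z|^2k that degenerates at the
   origin only. A segment of length s stays at distance at least s/4 from the
   origin on its first or last quarter, so the mean value theorem gives a gain
   of order s^(2k+1) over the whole segment, wherever it lies. Hence F maps each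
   square across itself with a margin depending on e only, and a smaller jump of
   the pseudoorbit keeps consecutive squares crossing. *)

(** * Polynomials as differentiable functions on the plane *)

(** Monomials are broken down further than in [mpolyind], so that each case of an induction matches
    one rule of differentiation: constant, coordinate, sum, product. *)
Lemma eval2_ind (R : realType) (S : mpoly 2 R -> Prop) :
  (forall c, S (mpolyC 2 c)) -> (forall i, S (mpolyX R (mnm1 i))) ->
  (forall p q, S p -> S q -> S (p + q)) ->
  (forall p q, S p -> S q -> S (p * q)) -> forall p, S p.
Proof.
move=> SC SX SD SM; elim/mpolyind => [|c m p _ _ Sp]; first by rewrite -mpolyC0.
apply: SD => //; rewrite -mul_mpolyC; apply: (SM) => //.
rewrite (mpolyXE _ (perm.perm_one 'I_2)); apply: (big_ind S) => //.
  by rewrite -mpolyC1.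
move=> i _; elim: (m _) => [|k IH]; rewrite ?expr0 -?mpolyC1 // exprS; exact: SM.
Qed.

Section Eval2.
Variable R : realType.
Implicit Types (p q : mpoly 2 R) (z v : R * R).

Lemma eval2C c z : eval2 (mpolyC 2 c) z = c.
Proof. exact: mevalC. Qed.

Lemma eval2D p q z : eval2 (p + q) z = eval2 p z + eval2 q z.
Proof. exact: mevalD. Qed.

Lemma eval2B p q z : eval2 (p - q) z = eval2 p z - eval2 q z.
Proof. exact: mevalB. Qed.

Lemma eval2M p q z : eval2 (p * q) z = eval2 p z * eval2 q z.
Proof. exact: mevalM. Qed.

Lemma differentiable_fst z : differentiable (@fst R R) z.
Proof. by apply: linear_differentiable => w; exact: cvg_fst. Qed.

Lemma differentiable_snd z : differentiable (@snd R R) z.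
Proof. by apply: linear_differentiable => w; exact: cvg_snd. Qed.

Lemma differentiable_eval2 p z : differentiable (eval2 p) z.
Proof.
elim/eval2_ind: p => [c|i|p q dp dq|p q dp dq].
- rewrite (_ : eval2 _ = cst c) //.
  by apply/funext => w; rewrite eval2C.
- case: (boolP (i == ord0)) => i0.
    rewrite (_ : eval2 _ = fst); first exact: differentiable_fst.
    by apply/funext => w; rewrite /eval2 mevalXU i0.
  rewrite (_ : eval2 _ = snd); first exact: differentiable_snd.
  by apply/funext => w; rewrite /eval2 mevalXU (negPf i0).
- rewrite (_ : eval2 _ = eval2 p + eval2 q); first exact: differentiableD.
  by apply/funext => w; rewrite eval2D.
- rewrite (_ : eval2 _ = eval2 p * eval2 q); first exact: differentiableM.
  by apply/funext => w; rewrite eval2M.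
Qed.

Lemma eval2_mderivXU (i j : 'I_2) z :
  eval2 (mderiv j (mpolyX R (mnm1 i))) z = (i == j)%:R.
Proof.
rewrite mderivX mnm1E; case: eqP => [->|_]; last first.
  by rewrite scale0r -mpolyC0 eval2C.
have -> : mnm_sub (mnm1 j) (mnm1 j) = mnm0.
  by apply/mnmP => l; rewrite mnmBE mnm0E subnn.
by rewrite scale1r mpolyX0 -mpolyC1 eval2C.
Qed.

Lemma is_derive_fst z v : is_derive z v (@fst R R) v.1.
Proof.
apply: DeriveDef; first exact/diff_derivable/differentiable_fst.
rewrite deriveE; last exact: differentiable_fst.
by rewrite (@diff_lin _ _ _ (@fst R R)) // => w; exact: cvg_fst.
Qed.

Lemma is_derive_snd z v : is_derive z v (@snd R R) v.2.
Proof.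
apply: DeriveDef; first exact/diff_derivable/differentiable_snd.
rewrite deriveE; last exact: differentiable_snd.
by rewrite (@diff_lin _ _ _ (@snd R R)) // => w; exact: cvg_snd.
Qed.

Lemma is_derive_eval2 p z v :
  is_derive z v (eval2 p) (eval2 (dx p) z * v.1 + eval2 (dy p) z * v.2).
Proof.
elim/eval2_ind: p => [c|i|p q dp dq|p q dp dq].
- rewrite (_ : eval2 _ = cst c); last by apply/funext => w; rewrite eval2C.
  apply: is_derive_eq.
  by rewrite /dx /dy !mderivC -mpolyC0 !eval2C !mul0r addr0.
- rewrite /dx /dy !eval2_mderivXU.
  case: (boolP (i == ord0)) => i0.
    rewrite (_ : eval2 _ = fst); last first.
      by apply/funext => w; rewrite /eval2 mevalXU i0.
    rewrite (eqP i0) /= mul1r mul0r addr0; exact: is_derive_fst.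
  have -> : i == ord_max by case: i i0 => [[|[|]]].
  rewrite mul0r mul1r add0r (_ : eval2 _ = snd); first exact: is_derive_snd.
  by apply/funext => w; rewrite /eval2 mevalXU (negPf i0).
- rewrite (_ : eval2 (p + q) = eval2 p + eval2 q); last first.
    by apply/funext => w; rewrite eval2D.
  apply: is_derive_eq; rewrite /dx /dy !mderivD !eval2D /dx /dy; ring.
- rewrite (_ : eval2 (p * q) = eval2 p * eval2 q); last first.
    by apply/funext => w; rewrite eval2M.
  apply: is_derive_eq; rewrite /dx /dy !mderivM !eval2D !eval2M
    /dx /dy /GRing.scale /=; ring.
Qed.

End Eval2.

(** * Increments of a function along a segment *)

(** Both derivatives are limits of literally the same difference quotient, so no chain rule is
    involved. *)
Lemma is_derive_line (R : realType) (u : R * R -> R) (p v : R * R) (t : R) :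
  differentiable u (p + t *: v) ->
  is_derive t 1 (fun s => u (p + s *: v)) ('D_v u (p + t *: v)).
Proof.
move=> du.
have E : (fun h : R => h^-1 *:
    (((fun s => u (p + s *: v)) \o shift t) (h *: 1) - u (p + t *: v))) =
  (fun h : R => h^-1 *: ((u \o shift (p + t *: v)) (h *: v) - u (p + t *: v))).
  apply/funext => h /=; congr (_ *: (u _ - _)).
  by rewrite scalerDl [h *: 1]mulr1 addrCA.
by apply: DeriveDef; rewrite ?/derive /derivable E //; exact: diff_derivable.
Qed.

(** Going from the midpoint value [a + b / 2] towards the end at which the absolute value grows, a
    parameter shift of at least 1/4 adds at least [|b| / 4]. The signs of [b] and of the midpoint
    value tell which end this is. *)
Lemma affine_quarter_bound (R : realFieldType) (a b : R) :
  (forall t, 0 <= t <= 1 / 4 -> `|b| / 4 <= `|a + t * b|) \/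
  (forall t, 3 / 4 <= t <= 1 -> `|b| / 4 <= `|a + t * b|).
Proof.
case: (ger0P b) => b0; case: (lerP 0 (a + b / 2)) => m0;
  [right|left|left|right] => t /andP[t0 t1]; rewrite ler_normr; apply/orP;
  [left|right|left|right]; nra.
Qed.

Lemma coordinate_norm_le (R : realType) (v : R * R) :
  `|v.1| <= `|v| /\ `|v.2| <= `|v|.
Proof. by rewrite prod_normE !le_max !lexx orbT. Qed.

(** The affine bound is applied to the coordinate in which [v] attains its sup norm. *)
Lemma segment_quarter_bound (R : realType) (p v : R * R) :
  (forall t, 0 <= t <= 1 / 4 -> `|v| / 4 <= `|p + t *: v|) \/
  (forall t, 3 / 4 <= t <= 1 -> `|v| / 4 <= `|p + t *: v|).
Proof.
have [vE|vE] : `|v| = `|v.1| \/ `|v| = `|v.2|.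
- by rewrite prod_normE; case: leP; [right|left].
- case: (affine_quarter_bound R p.1 v.1) => H; [left|right] => t ht;
  by rewrite vE (le_trans (H t ht)) // (coordinate_norm_le R (p + t *: v)).1.
- case: (affine_quarter_bound R p.2 v.2) => H; [left|right] => t ht;
  by rewrite vE (le_trans (H t ht)) // (coordinate_norm_le R (p + t *: v)).2.
Qed.

(** The mean value theorem is applied separately to the quarter that stays away from the origin and
    to the other three quarters, where only the slope [a] is kept. The factor [c / 4] comes from the
    length of that quarter, and [|v| / 4] is its distance to the origin. *)
Lemma segment_increment_le (R : realType) (u : R * R -> R) (p v : R * R)
    (a c : R) (n : nat) :
  (forall z, differentiable u z) -> 0 <= c ->
  (forall t, 0 <= t <= 1 ->
    'D_v u (p + t *: v) <= (a - c * `|p + t *: v| ^+ n) * `|v|) ->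
  u (p + v) - u p <= (a - c / 4 * (`|v| / 4) ^+ n) * `|v|.
Proof.
move=> du c0 dle; pose phi t := u (p + t *: v).
have incr (r s t : R) : 0 <= s -> s <= t -> t <= 1 -> 0 <= r ->
    (forall x, s <= x <= t -> r <= `|p + x *: v|) ->
    phi t - phi s <= (a - c * r ^+ n) * `|v| * (t - s).
  move=> s0 st t1 r0 far.
  have dphi (x : R) : is_derive x 1 phi ('D_v u (p + x *: v)).
    exact: is_derive_line.
  have [|x /[!in_itv]/= /andP[sx xt] ->] :=
      @MVT_segment R phi (fun x => 'D_v u (p + x *: v)) s t st.
  - apply: continuous_subspaceT => x.
    by apply/differentiable_continuous/derivable1_diffP; have := dphi x => -[].
  - apply: ler_wpM2r; first by rewrite subr_ge0.
    apply: (le_trans (dle x _)); first by apply/andP; split; lra.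
    apply: ler_wpM2r => //; rewrite lerD2l lerN2 ler_wpM2l //.
    by apply: lerXn2r; rewrite ?nnegrE // far // sx xt.
have phi0 : phi 0 = u p by rewrite /phi scale0r addr0.
have phi1 : phi 1 = u (p + v) by rewrite /phi scale1r.
have v0 : 0 <= `|v| / 4 by rewrite divr_ge0.
(* The case [r = 0] of [incr], with the nonnegative term [c * 0 ^+ n] dropped. *)
have dphi0 (s t : R) : 0 <= s -> s <= t -> t <= 1 ->
    phi t - phi s <= a * `|v| * (t - s).
  move=> s0 st t1; apply: (le_trans (incr 0 s t s0 st t1 (lexx _) _)) => //.
  apply: ler_wpM2r; first by rewrite subr_ge0.
  apply: ler_wpM2r => //.
  by have := mulr_ge0 c0 (exprn_ge0 n (lexx (0 : R))); lra.
rewrite -phi0 -phi1.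
case: (segment_quarter_bound R p v) => far.
- have h1 := incr _ 0 (1 / 4) (lexx _) ltac:(lra) ltac:(lra) v0 far.
  have h2 := dphi0 (1 / 4) 1 ltac:(lra) ltac:(lra) (lexx _).
  move: (_ ^+ n) h1 => X h1; lra.
- have h1 := incr _ (3 / 4) 1 ltac:(lra) ltac:(lra) (lexx _) v0 far.
  have h2 := dphi0 0 (3 / 4) (lexx _) ltac:(lra) ltac:(lra).
  move: (_ ^+ n) h1 => X h1; lra.
Qed.

(** * Shadowing from boxes that cross each other *)

Lemma continuous_pair (R : realType) (T : topologicalType) (f g : T -> R) :
  continuous f -> continuous g -> continuous (fun t => (f t, g t) : R * R).
Proof.
move=> fc gc t.
by apply: (@cvg_pair _ _ _ (nbhs t) (nbhs (f t)) (nbhs (g t)));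
  [exact: fc|exact: gc].
Qed.

(* The orbit is followed on a vertical segment, its height being clamped to the
   box at each step. Crossing keeps an orbit above (below) the box once it has
   left through the top (bottom), so one application of the intermediate value
   theorem at the last step yields an orbit that was never clamped. *)
Lemma shadowing_of_crossing (R : realType) (h : R * R -> R * R) (e : R)
    (m : nat) (p : nat -> R * R) :
  continuous h -> 0 < e ->
  (forall j w, (j < m)%N -> `|w.1 - (p j).1| <= e -> `|w.2 - (p j).2| <= e ->
    `|(h w).1 - (p j.+1).1| <= e) ->
  (forall j w, (j < m)%N -> `|w.1 - (p j).1| <= e -> w.2 = (p j).2 + e ->
    (p j.+1).2 + e < (h w).2) ->
  (forall j w, (j < m)%N -> `|w.1 - (p j).1| <= e -> w.2 = (p j).2 - e ->
    (h w).2 < (p j.+1).2 - e) ->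
  exists q, forall j, (j <= m)%N -> `|iter j h q - p j| <= e.
Proof.
move=> hc e0 hx htop hbot.
(* Only the height is clamped: [hx] already keeps the first coordinate inside the boxes. *)
pose clamp j (z : R * R) : R * R :=
  (z.1, Num.max ((p j).2 - e) (Num.min z.2 ((p j).2 + e))).
pose fix z (j : nat) (t : R) {struct j} : R * R :=
  if j is i.+1 then h (clamp i (z i t)) else ((p 0%N).1, t).
have clampc j : continuous (clamp j).
  apply: continuous_pair => w; first exact: cvg_fst.
  apply: (@continuous_max R _ (cst _) (fun z => Num.min z.2 _)).
    exact: cvg_cst.
  by apply: (@continuous_min R _ snd (cst _)); [exact: cvg_snd | exact: cvg_cst].
have zc j : continuous (z j).
  elim: j => [|j IH] /=.
    by apply: continuous_pair; [exact: cst_continuous | move=> t; exact: cvg_id].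
  move=> t.
  apply: (@continuous_comp _ _ _ (fun t => clamp j (z j t)) h); last exact: hc.
  by apply: (@continuous_comp _ _ _ (z j) (clamp j)); [exact: IH | exact: clampc].
have clamp_in j w : `|(clamp j w).2 - (p j).2| <= e.
  rewrite /clamp /= ler_norml; case: (leP w.2) => ?;
    case: (leP ((p j).2 - e)) => ?;
  apply/andP; split; lra.
have clamp_top j w : (p j).2 + e <= w.2 -> (clamp j w).2 = (p j).2 + e.
  by move=> hw; rewrite /clamp /=; case: (leP w.2) => ?;
    case: (leP ((p j).2 - e)) => ?; lra.
have clamp_bot j w : w.2 <= (p j).2 - e -> (clamp j w).2 = (p j).2 - e.
  by move=> hw; rewrite /clamp /=; case: (leP w.2) => ?;
    case: (leP ((p j).2 - e)) => ?; lra.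
have clamp_id j w : `|w.2 - (p j).2| <= e -> clamp j w = w.
  rewrite ler_norml => /andP[h1 h2]; rewrite /clamp [RHS]surjective_pairing.
  congr pair.
  by case: (leP w.2) => ?;
    case: (leP ((p j).2 - e)) => ?; lra.
have zx j t : (j <= m)%N -> `|(z j t).1 - (p j).1| <= e.
  elim: j => [|j IH] jm /=; first by rewrite subrr normr0 ltW.
  by apply: hx => //; apply: IH; exact: ltnW.
have ztop j : (j <= m)%N -> (p j).2 + e <= (z j ((p 0%N).2 + e)).2.
  elim: j => [|j IH] jm //=.
  by apply/ltW/htop => //=; [exact/zx/ltnW | exact/clamp_top/IH/ltnW].
have zbot j : (j <= m)%N -> (z j ((p 0%N).2 - e)).2 <= (p j).2 - e.
  elim: j => [|j IH] jm //=.
  by apply/ltW/hbot => //=; [exact/zx/ltnW | exact/clamp_bot/IH/ltnW].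
have [t _ zt] : exists2 t, t \in `[(p 0%N).2 - e, (p 0%N).2 + e] &
    (z m t).2 = (p m).2.
  apply: (@IVT R (fun t => (z m t).2)); first by lra.
    apply: continuous_subspaceT => t.
    by apply: (@continuous_comp _ _ _ (z m) snd); [exact: zc | exact: cvg_snd].
  have := ztop m (leqnn m); have := zbot m (leqnn m).
  by move=> ? ?; rewrite ge_min le_max; apply/andP; split;
    apply/orP; [left|right]; lra.
(* Induction backwards from the last index: a point outside its box would be clamped to the top or
   bottom edge, and the image of that edge misses the next box. *)
have zy j : (j <= m)%N -> `|(z (m - j)%N t).2 - (p (m - j)%N).2| <= e.
  elim: j => [|j IH] jm; first by rewrite subn0 zt subrr normr0 ltW.
  have /= := IH (ltnW jm); have -> : (m - j = (m - j.+1).+1)%N by rewrite subnSK.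
  have im : (m - j.+1 < m)%N by rewrite ltn_subrL (leq_trans _ jm).
  set i := (m - j.+1)%N in im *; rewrite !ler_norml => /andP[h1 h2].
  apply/andP; split; rewrite leNgt; apply/negP => hlt.
    have : (clamp i (z i t)).2 = (p i).2 - e by apply: clamp_bot; lra.
    move/(hbot i (clamp i (z i t)) im (zx _ _ (ltnW im))); rewrite /= in h1 h2; lra.
  have : (clamp i (z i t)).2 = (p i).2 + e by apply: clamp_top; lra.
  by move/(htop i (clamp i (z i t)) im (zx _ _ (ltnW im))); rewrite /= in h1 h2; lra.
have {}zy j : (j <= m)%N -> `|(z j t).2 - (p j).2| <= e.
  by move=> jm; rewrite -(subKn jm); apply/zy/leq_subr.
have zE j : (j <= m)%N -> z j t = iter j h (z 0%N t).
  elim: j => [|j IH] jm //=; rewrite clamp_id; last exact/zy/ltnW.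
  by rewrite IH // ltnW.
exists (z 0%N t) => j jm; rewrite -zE // prod_normE ge_max.
by rewrite zx // zy.
Qed.

(** * Lower bounds for positive definite forms *)

Lemma tensor_formZ (R : realType) (n m : nat) (B : tensor R n m) (a : R)
    (x : 'rV[R]_n) :
  tensor_form B (a *: x) = a ^+ m * tensor_form B x.
Proof.
rewrite /tensor_form mulr_sumr; apply: eq_bigr => t _; rewrite mulrCA.
congr (_ * _); under eq_bigr => i _ do rewrite mxE.
by rewrite big_split /= big_const_seq count_predT size_tuple iter_mulr_1.
Qed.

(** By homogeneity a bound on the boundary of the sup-norm unit square suffices. The degree is even,
    so opposite sides carry the same values and only the sides [(1, t)] and [(t, 1)] remain; on each
    the extreme value theorem gives a positive minimum. *)
Lemma positive_definite_bound (R : realType) (k : nat) (q : mpoly 2 R)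
    (B : tensor R 2 (2 * k)) :
  coefficient_tensor B q -> positive_definite B ->
  exists2 c : R, 0 < c & forall z, c * `|z| ^+ (2 * k) <= eval2 q z.
Proof.
move=> [_ Bq] Bpos.
pose row2 (z : R * R) : 'rV[R]_2 := \row_i (if i == ord0 then z.1 else z.2).
have evalE z : eval2 q z = tensor_form B (row2 z).
  by rewrite -Bq; congr (meval _ q); apply/funext => i; rewrite mxE.
have evalZ a z : eval2 q (a *: z) = a ^+ (2 * k) * eval2 q z.
  rewrite !evalE -tensor_formZ; congr (tensor_form B _).
  by apply/rowP => i; rewrite !mxE; case: ifP.
have eval_gt0 z : z != 0 -> 0 < eval2 q z.
  move=> z0; rewrite evalE; apply: Bpos; apply: contra z0 => /eqP /rowP zE.
  have /= z1 := zE ord0; have /= z2 := zE ord_max; rewrite !mxE /= in z1 z2.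
  by rewrite [z]surjective_pairing z1 z2.
have min_line (l : R -> R * R) : continuous l -> (forall t, l t != 0) ->
    exists2 c : R, 0 < c & forall t, `|t| <= 1 -> c <= eval2 q (l t).
  move=> lc l0.
  have [||c _ cmin] := @EVT_min R (fun t => eval2 q (l t)) (-1) 1.
  - lra.
  - apply: continuous_subspaceT => t.
    apply: (@continuous_comp _ _ _ l (eval2 q)); first exact: lc.
    exact/differentiable_continuous/differentiable_eval2.
  - exists (eval2 q (l c)) => [|t]; first exact: eval_gt0.
    by rewrite ler_norml => t1; apply: cmin; rewrite in_itv.
have [||c1 c10 min1] := min_line (fun t => (1, t)).
- by apply: continuous_pair; [exact: cst_continuous | move=> t; exact: cvg_id].
- by move=> t; rewrite xpair_eqE oner_eq0.
have [||c2 c20 min2] := min_line (fun t => (t, 1)).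
- by apply: continuous_pair; [move=> t; exact: cvg_id | exact: cst_continuous].
- by move=> t; rewrite xpair_eqE oner_eq0 andbF.
exists (Num.min c1 c2) => [|z]; first by rewrite lt_min c10.
have even_norm (x : R) : `|x| ^+ (2 * k) = x ^+ (2 * k).
  by rewrite !exprM real_normK // num_real.
have even_ge0 (x : R) : 0 <= x ^+ (2 * k) by rewrite -even_norm exprn_ge0.
(* As [x / 0 = 0], this and the next fact also hold for [y = 0], and [z = 0] needs no separate case
   below. *)
have div_le1 (x y : R) : `|x| <= `|y| -> `|x / y| <= 1.
  have [->|y0] := eqVneq y 0; first by rewrite invr0 mulr0 normr0.
  by rewrite normrM normfV ler_pdivrMr ?mul1r // normr_gt0.
have mul_div (x y : R) : `|x| <= `|y| -> y * (x / y) = x.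
  have [->|y0] := eqVneq y 0; last by rewrite mulrC divfK.
  by rewrite normr0 normr_le0 => /eqP ->; rewrite !mul0r.
rewrite mulrC prod_normE; case: (leP `|z.1|) => [z12|/ltW z21].
- have -> : z = z.2 *: (z.1 / z.2, 1).
    by rewrite [LHS]surjective_pairing; congr pair;
    rewrite /= /GRing.scale /= ?mulr1 ?mul_div.
  rewrite evalZ /= [_ *: 1]mulr1 even_norm; apply: ler_wpM2l => //.
  by rewrite ge_min min2 ?orbT // div_le1.
- have -> : z = z.1 *: (1, z.2 / z.1).
    by rewrite [LHS]surjective_pairing; congr pair;
    rewrite /= /GRing.scale /= ?mulr1 ?mul_div.
  rewrite evalZ /= [_ *: 1]mulr1 even_norm; apply: ler_wpM2l => //.
  by rewrite ge_min min1 // div_le1.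
Qed.

(** * Comparison of norms and control of the higher-order terms *)

Lemma norm_le_eunorm (R : realType) (z : R * R) : `|z| <= eunorm z.
Proof.
rewrite prod_normE ge_max /eunorm -!sqrtr_sqr; apply/andP; split;
  apply: ler_wsqrtr; rewrite ?lerDl ?lerDr sqr_ge0 //.
Qed.

Lemma eunorm_le_norm (R : realType) (z : R * R) : eunorm z <= 2 * `|z|.
Proof.
have [z1 z2] := coordinate_norm_le R z.
rewrite /eunorm -[leRHS]ger0_norm ?mulr_ge0 // -sqrtr_sqr; apply: ler_wsqrtr.
rewrite -(real_normK (num_real z.1)) -(real_normK (num_real z.2)).
have := normr_ge0 z.1; have := normr_ge0 z.2; nra.
Qed.

Lemma deriveE_pair (R : realType) (f : R * R -> R) (z v : R * R) :
  differentiable f z ->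
  'D_v f z = v.1 * 'D_(1, 0) f z + v.2 * 'D_(0, 1) f z.
Proof.
move=> df; rewrite !deriveE //.
have {1}-> : v = v.1 *: (1, 0) + v.2 *: (0, 1).
  rewrite [LHS]surjective_pairing; congr pair;
  by rewrite /= /GRing.scale /= ?mulr1 ?mulr0 ?addr0 ?add0r.
by rewrite linearD !linearZ.
Qed.

(** A directional derivative combines the two partial derivatives with coefficients of size at most
    [|v|], so one neighborhood serves all directions at once. *)
Lemma higher_order_derive_near (R : realType) (d : nat) (f : R * R -> R)
    (c : R) :
  higher_order_term d f -> 0 < c ->
  \forall z \near (0 : R * R), forall v, `|'D_v f z| <= c * `|z| ^+ d * `|v|.
Proof.
move=> [[df _ _] _ /eqoP fx /eqoP fy] c0.
(* The first 2 shares [c] between the two partial derivatives; [2 ^+ d] pays for passing from the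
   Euclidean norm to the sup norm. *)
have c'0 : 0 < c / 2 / 2 ^+ d by rewrite !divr_gt0 // exprn_gt0.
near=> z; move=> v; rewrite deriveE_pair //.
have := eunorm_le_norm R z; have : 0 <= eunorm z by exact: sqrtr_ge0.
move=> e0 ele.
have bound : c / 2 / 2 ^+ d * `|eunorm z ^+ d| <= c / 2 * `|z| ^+ d.
  rewrite -mulrA; apply: ler_wpM2l; first by rewrite divr_ge0 // ltW.
  rewrite ger0_norm ?exprn_ge0 // ler_pdivrMl ?exprn_gt0 // -exprMn.
  by apply: lerXn2r; rewrite ?nnegrE // mulr_ge0.
have [v1 v2] := coordinate_norm_le R v.
have fxz : `|'D_(1, 0) f z| <= c / 2 * `|z| ^+ d.
  by apply: le_trans bound; near: z; exact: fx.
have fyz : `|'D_(0, 1) f z| <= c / 2 * `|z| ^+ d.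
  by apply: le_trans bound; near: z; exact: fy.
apply: (le_trans (ler_normD _ _)); rewrite !normrM.
have -> : c * `|z| ^+ d * `|v| =
  `|v| * (c / 2 * `|z| ^+ d) + `|v| * (c / 2 * `|z| ^+ d) by field.
by rewrite lerD // ler_pM.
Unshelve. all: end_near.
Qed.

(** * Contraction and expansion near the origin *)

Lemma coefficient_tensor_eval2_0 (R : realType) (n : nat) (q : mpoly 2 R)
    (B : tensor R 2 n) :
  (0 < n)%N -> coefficient_tensor B q -> eval2 q 0 = 0.
Proof.
move=> n0 [_ Bq]; have -> : eval2 q 0 = tensor_form B 0.
  by rewrite -Bq; congr (meval _ q); apply/funext => i; rewrite mxE if_same.
by rewrite -(scale0r 0) tensor_formZ expr0n eqn0Ngt n0 mul0r.
Qed.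

(** Write [N] for [|z| ^+ (2 * k)] and [Px], [Py] for the partial derivatives of [P]. The forms of
    [C] and [D] give [|Py| <= Px - c * N], so the coefficients [1 - Px] of [v.1] and [- Py] of [v.2]
    have absolute values summing to at most [1 - c * N]. Half of [c] then absorbs the derivative of
    [X]. *)
Lemma derive_contraction_near (R : realType) (k : nat) (P : mpoly 2 R)
    (X : R * R -> R) (A C D : tensor R 2 (2 * k)) :
  (1 <= k)%N -> higher_order_term (2 * k) X ->
  coefficient_tensor A (dx P) ->
  coefficient_tensor C (dx P + dy P) -> coefficient_tensor D (dx P - dy P) ->
  positive_definite C -> positive_definite D ->
  exists2 c : R, 0 < c & \forall z \near (0 : R * R), forall v,
    'D_v (fun z => z.1 - eval2 P z + X z) z <=
      (1 - c * `|z| ^+ (2 * k)) * `|v|.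
Proof.
move=> k0 hX hA hC hD pC pD.
have [c1 c10 le1] := positive_definite_bound _ _ _ _ hC pC.
have [c2 c20 le2] := positive_definite_bound _ _ _ _ hD pD.
pose c := Num.min c1 c2; have c0 : 0 < c by rewrite lt_min c10.
have cc1 : c <= c1 by rewrite ge_min lexx.
have cc2 : c <= c2 by rewrite ge_min lexx orbT.
have c20' : 0 < c / 2 by rewrite divr_gt0.
exists (c / 2) => //.
(* Makes the coefficient [1 - Px] of [v.1] positive, so that it equals its absolute value. *)
have Px0 : \forall z \near (0 : R * R), `|eval2 (dx P) z| < 1.
  have P0 : eval2 (dx P) (0 : R * R) = 0.
    by apply: coefficient_tensor_eval2_0 hA; rewrite muln_gt0.
  have /cvgr_dist_lt/(_ 1 ltr01) :=
    differentiable_continuous (differentiable_eval2 _ (dx P) (0 : R * R)).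
  by apply: filterS => z; rewrite [X in `|X - _|]P0 sub0r normrN.
have dX : forall z, differentiable X z by case: hX => -[].
near=> z; move=> v.
have ->: 'D_v (fun z => z.1 - eval2 P z + X z) z = v.1 -
    (eval2 (dx P) z * v.1 + eval2 (dy P) z * v.2) + 'D_v X z.
  apply: derive_val; apply: is_deriveD; last exact/derivableP/diff_derivable.
  by apply: is_deriveB; [exact: is_derive_fst | exact: is_derive_eval2].
have hXz : `|'D_v X z| <= c / 2 * `|z| ^+ (2 * k) * `|v|.
  by move: v; near: z; exact: (higher_order_derive_near _ _ _ _ hX c20').
have Pxz : `|eval2 (dx P) z| < 1 by near: z.
have := le1 z; have := le2 z; rewrite eval2B eval2D.
have [v1 v2] := coordinate_norm_le R v.
have N0 : 0 <= `|z| ^+ (2 * k) by exact: exprn_ge0.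
move: (eval2 (dx P) z) (eval2 (dy P) z) (`|z| ^+ (2 * k)) ('D_v X z) hXz Pxz N0.
move=> Px Py N DX.
rewrite !ler_norml ltr_norml in v1 v2 *.
move=> /andP[_ hDX] /andP[_ Px1] N0 le2z le1z.
case/andP: v1 => v1 v1'; case/andP: v2 => v2 v2'.
have l1 : c * N <= Px + Py by apply: le_trans le1z; exact: ler_wpM2r.
have l2 : c * N <= Px - Py by apply: le_trans le2z; exact: ler_wpM2r.
have t1 : (1 - Px) * v.1 <= (1 - Px) * `|v| by apply: ler_wpM2l => //; lra.
have t2 : - Py * v.2 <= (Px - c * N) * `|v| by nra.
lra.
Unshelve. all: end_near.
Qed.

(** In the downward cone [|v| = - v.2], and the forms of [E] and [H] give [|Qx| <= Qy - c * N], so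
    the vertical gain outweighs the shear [Qx * v.1]. Taking downward vectors turns expansion into
    an upper bound, the shape required by [segment_increment_le] with [a = -1]. *)
Lemma derive_expansion_near (R : realType) (k : nat) (Q : mpoly 2 R)
    (Y : R * R -> R) (E H : tensor R 2 (2 * k)) :
  higher_order_term (2 * k) Y ->
  coefficient_tensor E (dy Q + dx Q) -> coefficient_tensor H (dy Q - dx Q) ->
  positive_definite E -> positive_definite H ->
  exists2 c : R, 0 < c & \forall z \near (0 : R * R), forall v,
    `|v.1| <= - v.2 -> 'D_v (fun z => z.2 + eval2 Q z + Y z) z <=
      (- 1 - c * `|z| ^+ (2 * k)) * `|v|.
Proof.
move=> hY hE hH pE pH.
have [c1 c10 le1] := positive_definite_bound _ _ _ _ hE pE.
have [c2 c20 le2] := positive_definite_bound _ _ _ _ hH pH.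
pose c := Num.min c1 c2; have c0 : 0 < c by rewrite lt_min c10.
have cc1 : c <= c1 by rewrite ge_min lexx.
have cc2 : c <= c2 by rewrite ge_min lexx orbT.
have c20' : 0 < c / 2 by rewrite divr_gt0.
exists (c / 2) => //.
have dY : forall z, differentiable Y z by case: hY => -[].
near=> z; move=> v v12.
have ->: 'D_v (fun z => z.2 + eval2 Q z + Y z) z = v.2 +
    (eval2 (dx Q) z * v.1 + eval2 (dy Q) z * v.2) + 'D_v Y z.
  apply: derive_val; apply: is_deriveD; last exact/derivableP/diff_derivable.
  by apply: is_deriveD; [exact: is_derive_snd | exact: is_derive_eval2].
have hYz : `|'D_v Y z| <= c / 2 * `|z| ^+ (2 * k) * `|v|.
  by move: v {v12}; near: z; exact: (higher_order_derive_near _ _ _ _ hY c20').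
have := le1 z; have := le2 z; rewrite eval2B eval2D.
have N0 : 0 <= `|z| ^+ (2 * k) by exact: exprn_ge0.
move: hYz; have -> : `|v| = - v.2.
  have v20 : v.2 <= 0 by rewrite -oppr_ge0 (le_trans _ v12).
  by rewrite prod_normE (ler0_norm v20); apply/max_idPr.
move: (eval2 (dx Q) z) (eval2 (dy Q) z) (`|z| ^+ (2 * k)) ('D_v Y z) N0.
move=> Qx Qy N DY N0; move: v12; rewrite !ler_norml.
move=> /andP[v1 v1'] /andP[_ hDY] le2z le1z.
have l1 : c * N <= Qy + Qx by apply: le_trans le1z; exact: ler_wpM2r.
have l2 : c * N <= Qy - Qx by apply: le_trans le2z; exact: ler_wpM2r.
have t2 : Qx * v.1 <= (Qy - c * N) * - v.2 by nra.
lra.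
Unshelve. all: end_near.
Qed.

(* The gap is uniform over [0 <= s <= e]: small [s] loses nothing, and for
   [s >= e / 2] the term in [c] is bounded below. *)
Lemma increment_gap (R : realType) (c e : R) (n : nat) :
  0 < c -> 0 < e ->
  exists2 eta : R, 0 < eta & forall s, 0 <= s <= e ->
    (1 - c * (s / 4) ^+ n) * s <= e - eta.
Proof.
move=> c0 e0; pose gap := c * (e / 8) ^+ n * (e / 2).
exists (Num.min (e / 2) gap).
  by rewrite lt_min !mulr_gt0 // exprn_gt0 // divr_gt0.
move=> s /andP[s0 se].
have m1 : Num.min (e / 2) gap <= e / 2 by rewrite ge_min lexx.
have m2 : Num.min (e / 2) gap <= gap by rewrite ge_min lexx orbT.
case: (lerP s (e / 2)) => [s2|/ltW s2].
  have : 0 <= c * (s / 4) ^+ n * s.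
    by rewrite !mulr_ge0 // ?exprn_ge0 ?divr_ge0 // ltW.
  lra.
have : gap <= c * (s / 4) ^+ n * s.
  apply: ler_pM => //; [|lra|].
    by rewrite mulr_ge0 ?exprn_ge0 ?divr_ge0 // ltW.
  by rewrite ler_pM2l //; apply: lerXn2r; rewrite ?nnegrE; lra.
lra.
Qed.

(** * Finite shadowing near the origin *)

Lemma eunorm_lt (R : realType) (z : R * R) (e : R) :
  0 < e -> `|z| <= e / 3 -> eunorm z < e.
Proof. by move=> e0 ze; have := eunorm_le_norm R z; lra. Qed.

Theorem theorem1p3 (R : realType) (k k' : nat) (hk : (1 <= k)%N)
    (hk' : (1 <= k')%N) (P Q : mpoly 2 R) (X Y : R * R -> R)
    (hP : homogeneous (2 * k + 1) P) (hQ : homogeneous (2 * k' + 1) Q)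
    (hX : higher_order_term (2 * k) X) (hY : higher_order_term (2 * k') Y)
    (A C D : tensor R 2 (2 * k)) (B E H : tensor R 2 (2 * k'))
    (hA : coefficient_tensor A (dx P)) (hB : coefficient_tensor B (dy Q))
    (hC : coefficient_tensor C (dx P + dy P))
    (hD : coefficient_tensor D (dx P - dy P))
    (hE : coefficient_tensor E (dy Q + dx Q))
    (hH : coefficient_tensor H (dy Q - dx Q))
    (pA : positive_definite A) (pB : positive_definite B)
    (pC : positive_definite C) (pD : positive_definite D)
    (pE : positive_definite E) (pH : positive_definite H) :
  exists2 K : set (R * R), nbhs (0 : R * R) K &
    finite_shadowing (@eudist R) (planar_map P Q X Y) K.
Proof.
have dX : forall z, differentiable X z by case: hX => -[].
have dY : forall z, differentiable Y z by case: hY => -[].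
pose f (z : R * R) := z.1 - eval2 P z + X z.
pose g (z : R * R) := z.2 + eval2 Q z + Y z.
have df z : differentiable f z.
  apply: differentiableD => //; apply: differentiableB.
    exact: differentiable_fst.
  exact: differentiable_eval2.
have dg z : differentiable g z.
  apply: differentiableD => //; apply: differentiableD.
    exact: differentiable_snd.
  exact: differentiable_eval2.
have hc : continuous (planar_map P Q X Y).
  apply: (@continuous_pair R _ f g) => z;
  exact/differentiable_continuous.
have [c c0 fle] := derive_contraction_near _ _ _ _ _ _ _ hk hX hA hC hD pC pD.
have [c' c'0 gle] := derive_expansion_near _ _ _ _ _ _ hY hE hH pE pH.
have [r /= r0 near0] := (nbhs_normP _ _).1
  (@filterI _ _ (nbhs_filter _) _ _ fle gle).
have {}fle z : `|z| < r -> forall v,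
    'D_v f z <= (1 - c * `|z| ^+ (2 * k)) * `|v|.
  by move=> zr; have [] := near0 z; rewrite //= sub0r normrN.
have {}gle z : `|z| < r -> forall v, `|v.1| <= - v.2 ->
    'D_v g z <= (- 1 - c' * `|z| ^+ (2 * k')) * `|v|.
  by move=> zr; have [] := near0 z; rewrite //= sub0r normrN.
have finc (p v : R * R) :
    (forall t, 0 <= t <= 1 -> `|p + t *: v| < r) ->
    f (p + v) - f p <= (1 - c / 4 * (`|v| / 4) ^+ (2 * k)) * `|v|.
  move=> pv; apply: segment_increment_le => //; first exact: ltW.
  by move=> t t01; apply/fle/pv.
have ginc (p v : R * R) : `|v.1| <= - v.2 ->
    (forall t, 0 <= t <= 1 -> `|p + t *: v| < r) ->
    g (p + v) - g p <= (- 1 - c' / 4 * (`|v| / 4) ^+ (2 * k')) * `|v|.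
  move=> v12 pv; apply: segment_increment_le => //; first exact: ltW.
  by move=> t t01; apply: gle => //; exact: pv.
exists (ball (0 : R * R) (r / 2)).
  by apply: nbhsx_ballx; rewrite divr_gt0.
(* The bound [eps / 3] leaves room for the factor 2 between the norms. With [r / 4], a box centered
   in the ball of radius [r / 2] stays within [3 * r / 4] of the origin, where the derivative bounds
   hold. *)
move=> eps eps0; pose e := Num.min (eps / 3) (r / 4).
have e0 : 0 < e by rewrite lt_min !divr_gt0.
have e_eps : e <= eps / 3 by rewrite ge_min lexx.
have e_r : e <= r / 4 by rewrite ge_min lexx orbT.
have c40 : 0 < c / 4 by rewrite divr_gt0.
have c'40 : 0 < c' / 4 by rewrite divr_gt0.
have [eta eta0 gap] := increment_gap _ _ _ (2 * k) c40 e0.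
(* The excess of [ginc] over [e] when [|v| = e]. Vectors from the center to the top or bottom edge
   have sup norm exactly [e], so no minimum over lengths is taken here. *)
pose eta' := c' / 4 * (e / 4) ^+ (2 * k') * e.
have eta'E : eta' = c' / 4 * (e / 4) ^+ (2 * k') * e by [].
have eta'0 : 0 < eta' by rewrite !mulr_gt0 // exprn_gt0 // divr_gt0.
exists (Num.min eta eta') => [|m p pK pseudo]; first by rewrite lt_min eta0.
have jump j : (j < m)%N ->
    `|f (p j) - (p j.+1).1| < eta /\ `|g (p j) - (p j.+1).2| < eta'.
  move=> jm; have := pseudo j jm; rewrite /eudist => lt_eta.
  have := le_lt_trans (norm_le_eunorm _ _) lt_eta.
  rewrite prod_normE gt_max !lt_min => /andP[/andP[h1 _] /andP[_ h2]].
  by split; rewrite distrC.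
have near_p j t w : (j < m)%N -> `|w - p j| <= e -> 0 <= t <= 1 ->
    `|p j + t *: (w - p j)| < r.
  move=> jm wp /andP[t0 t1].
  have pr : `|p j| < r / 2.
    by have := pK j (ltnW jm); rewrite -ball_normE /= sub0r normrN.
  apply: (le_lt_trans (ler_normD _ _)); rewrite normrZ ger0_norm //.
  have : t * `|w - p j| <= 1 * e by apply: ler_pM.
  lra.
have near_w j t w : (j < m)%N -> `|w - p j| <= e -> 0 <= t <= 1 ->
    `|w + t *: (p j - w)| < r.
  move=> jm wp /andP[t0 t1].
  have -> : w + t *: (p j - w) = p j + (1 - t) *: (w - p j).
    rewrite scalerBl scale1r -[p j - w]opprB scalerN addrA.
    by rewrite [p j + _]addrC subrK.
  by apply: near_p => //; apply/andP; split; lra.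
have box j w : `|w.1 - (p j).1| <= e -> `|w.2 - (p j).2| <= e ->
    `|w - p j| <= e.
  by move=> h1 h2; rewrite prod_normE ge_max h1.
have [|||q hq] := @shadowing_of_crossing R (planar_map P Q X Y) e m p hc e0.
(* [finc] is one-sided, so it is used in both directions between [p j] and [w]. The images then
   differ by at most [e - eta] in the first coordinate, and the jump adds less than [eta]. *)
- move=> j w jm w1 w2; have wp := box j w w1 w2.
  have := finc (p j) (w - p j) (fun t => near_p j t w jm wp).
  have := finc w (p j - w) (fun t => near_w j t w jm wp).
  rewrite !subrKC distrC => h1 h2.
  have gap_w := gap `|w - p j| ltac:(by rewrite normr_ge0).
  have [] := jump j jm; rewrite -[(planar_map _ _ _ _ w).1]/(f w).
  rewrite ltr_norml ler_norml => /andP[? ?] _.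
  by apply/andP; split; lra.
(* From the top edge, the vector to the center points down and lies in the cone; the images separate
   by at least [e + eta'], more than the jump can undo. *)
- move=> j w jm w1 w2.
  have vE : (p j - w).2 = - e by rewrite /= w2; ring.
  have wp : `|w - p j| <= e by apply: box => //; rewrite w2 addrC addKr gtr0_norm.
  have vN : `|p j - w| = e.
    apply/le_anti; rewrite distrC wp /= distrC.
    by have [_] := coordinate_norm_le R (p j - w); rewrite vE normrN gtr0_norm.
  have := ginc w (p j - w) _ (fun t => near_w j t w jm wp).
  rewrite vE opprK vN subrKC distrC w1 => /(_ isT) h1.
  have [_] := jump j jm; rewrite -[(planar_map _ _ _ _ w).2]/(g w).
  by rewrite ltr_norml => /andP[? ?]; lra.
(* From the bottom edge the roles swap: the downward vector goes from the center to [w]. *)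
- move=> j w jm w1 w2.
  have vE : (w - p j).2 = - e by rewrite /= w2; ring.
  have wp : `|w - p j| <= e.
    by apply: box => //; rewrite w2 addrC addKr normrN gtr0_norm.
  have vN : `|w - p j| = e.
    apply/le_anti; rewrite wp /=.
    by have [_] := coordinate_norm_le R (w - p j); rewrite vE normrN gtr0_norm.
  have := ginc (p j) (w - p j) _ (fun t => near_p j t w jm wp).
  rewrite vE opprK vN subrKC w1 => /(_ isT) h1.
  have [_] := jump j jm; rewrite -[(planar_map _ _ _ _ w).2]/(g w).
  by rewrite ltr_norml => /andP[? ?]; lra.
- exists q => j jm; apply: eunorm_lt => //.
  exact: le_trans (hq j jm) e_eps.
Qed.
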